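(* Suppose Assumption A holds with $\beta,\gamma\in(0,\infty)$ and the noise satisfies Assumption B. Let $$\theta=\frac{\mu^2\gamma\rho^2(\gamma+2\beta)+8L^2}{2\mu\gamma\rho^2},\qquad\kappa=\frac{\mu\gamma}{2},$$ and run MD-SP with noisy feedback and learning rates $\eta_t=1/(\kappa t+2\theta)$ from an arbitrary $\pi^0\in\mathcal X$. Then for all $t\ge0$, $$\mathbb E[D_\psi(\pi^{\mu,\sigma},\pi^{t+1})]\le\frac{2\theta-\kappa}{\kappa t+2\theta}D_\psi(\pi^{\mu,\sigma},\pi^0)+\frac{NC^2}{\rho(\kappa t+2\theta)}\Big(\frac1\kappa\log\Big(\frac\kappa{2\theta}t+1\Big)+\frac1{2\theta}\Big).$$
   Context: Game. Let $N\ge1$. For each $i\in[N]$, $\mathcal X_i\subseteq\mathbb R^{d_i}$ is a nonempty compact convex set, and $\mathcal X=\prod_i\mathcal X_i$. Each $v_i:\mathcal X\to\mathbb R$ is differentiable, with block gradient $\nabla_{\pi_i}v_i$. The norm is Euclidean, with $\|\pi\|^2=\sum_i\|\pi_i\|^2$. The game is monotone: $\sum_i\langle\nabla_{\pi_i}v_i(\pi)-\nabla_{\pi_i}v_i(\pi'),\pi_i-\pi_i'\rangle\le0$. The game is $L$-smooth: $\sum_i\|\nabla_{\pi_i}v_i(\pi)-\nabla_{\pi_i}v_i(\pi')\|^2\le L^2\|\pi-\pi'\|^2$. Regularizer. $\psi:\mathcal X_i\to\mathbb R$ is differentiable on $\mathcal X_i$ and $\rho$-strongly convex with respect to $\|\cdot\|$.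 Bregman divergence: $D_\psi(x,y)=\psi(x)-\psi(y)-\langle\nabla\psi(y),x-y\rangle$, and $D_\psi(\pi,\pi')=\sum_iD_\psi(\pi_i,\pi_i')$. Perturbation. $G:\mathcal X_i\times\mathcal X_i\to[0,\infty)$ is differentiable in its first argument, with gradient $\nabla_{\pi_i}G$ in that argument. $G(\cdot,\sigma_i)$ is strictly convex with minimum value $0$ at $\sigma_i$. For $\mu>0$ and $\sigma\in\mathcal X$, $\pi^{\mu,\sigma}$ is a profile with $\pi_i^{\mu,\sigma}\in\arg\max_{\pi_i}\{v_i(\pi_i,\pi^{\mu,\sigma}_{-i})-\mu G(\pi_i,\sigma_i)\}$ for all $i$. Assumption A: for all $\sigma_i,\pi_i,\pi_i'\in\mathcal X_i$, $$\gamma D_\psi(\pi_i',\pi_i)\le G(\pi_i',\sigma_i)-G(\pi_i,\sigma_i)-\langle\nabla_{\pi_i}G(\pi_i,\sigma_i),\pi_i'-\pi_i\rangle\le\beta D_\psi(\pi_i',\pi_i).$$ MD-SP with noisy feedback: $$\pi_i^{t+1}=\arg\max_{x\in\mathcal X_i}\{\eta_t\langle\nabla_{\pi_i}v_i(\pi^t)+\xi_i^t-\mu\nabla_{\pi_i}G(\pi_i^t,\sigma_i),x\rangle-D_\psi(x,\pi_i^t)\}.$$ $\mathcal F_t$ is the sigma-algebra generated by the feedback $(\nabla_{\pi_i}v_i(\pi^s)+\xi_i^s)_{i}$ for $s<t$. Assumption B: $\mathbb E[\xi_i^t\mid\mathcal F_t]=0$ and $\mathbb E[\|\xi_i^t\|^2\mid\mathcal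 F_t]\le C^2$ for all $i,t$. *)

(* Defs.v *)
From HB Require Import structures.
From mathcomp Require Import all_boot all_order all_algebra.
From mathcomp Require Import all_classical all_reals all_analysis.
Set Implicit Arguments. Unset Strict Implicit. Unset Printing Implicit Defensive.
Import Order.TTheory GRing.Theory Num.Theory.
Import numFieldNormedType.Exports.
Local Open Scope ring_scope.
Local Open Scope classical_set_scope.

Section Defs.
Variable R : realType.

Definition dotv n (x y : 'rV[R]_n) : R := \sum_(j < n) x ord0 j * y ord0 j.
Definition sqn n (x : 'rV[R]_n) : R := dotv x x.
Definition enorm n (x : 'rV[R]_n) : R := Num.sqrt (sqn x).

Definition convex_rv n (S : set 'rV[R]_n) : Prop :=
  forall x y l, S x -> S y -> 0 <= l <= 1 -> S (l *: x + (1 - l) *: y).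

Definition has_grad n (f : 'rV[R]_n -> R) (g : 'rV[R]_n) (x : 'rV[R]_n) : Prop :=
  forall e : R, 0 < e -> exists2 del : R, 0 < del &
    forall y, enorm (y - x) < del ->
      `|f y - f x - dotv g (y - x)| <= e * enorm (y - x).

Definition strongly_convex_on n (rho : R) (S : set 'rV[R]_n) (f : 'rV[R]_n -> R) :=
  forall x y l, S x -> S y -> 0 <= l <= 1 ->
    f (l *: x + (1 - l) *: y) <=
      l * f x + (1 - l) * f y - rho / 2 * l * (1 - l) * sqn (x - y).

Definition strictly_convex_on n (S : set 'rV[R]_n) (f : 'rV[R]_n -> R) :=
  forall x y l, S x -> S y -> x != y -> 0 < l < 1 ->
    f (l *: x + (1 - l) *: y) < l * f x + (1 - l) * f y.

Definition bregman n (psi : 'rV[R]_n -> R) (gpsi : 'rV[R]_n -> 'rV[R]_n)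
  (x y : 'rV[R]_n) : R := psi x - psi y - dotv (gpsi y) (x - y).

Definition prof N (d : 'I_N -> nat) := forall i : 'I_N, 'rV[R]_(d i).

Definition in_prof N (d : 'I_N -> nat) (X : forall i, set 'rV[R]_(d i))
  (p : prof d) : Prop := forall i, X i (p i).

Definition subp N (d : 'I_N -> nat) (p q : prof d) : prof d := fun i => p i - q i.

Definition sqnp N (d : 'I_N -> nat) (p : prof d) : R := \sum_(i < N) sqn (p i).
Definition enormp N (d : 'I_N -> nat) (p : prof d) : R := Num.sqrt (sqnp p).

Definition upd N (d : 'I_N -> nat) (p : prof d) (i : 'I_N) (x : 'rV[R]_(d i))
  : prof d :=
  fun j => match i =P j with
           | ReflectT e => ecast k 'rV[R]_(d k) e x
           | ReflectF _ => p j
           end.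

Definition prof_diff N (d : 'I_N -> nat) (f : prof d -> R) (D p : prof d) : Prop :=
  forall e : R, 0 < e -> exists2 del : R, 0 < del &
    forall q, enormp (subp q p) < del ->
      `|f q - f p - \sum_(j < N) dotv (D j) (q j - p j)| <= e * enormp (subp q p).

Definition bregp N (d : 'I_N -> nat) (psi : forall i, 'rV[R]_(d i) -> R)
  (gpsi : forall i, 'rV[R]_(d i) -> 'rV[R]_(d i)) (p q : prof d) : R :=
  \sum_(i < N) bregman (psi i) (gpsi i) (p i) (q i).

Definition theta_const (mu gam rho beta L : R) : R :=
  (mu ^+ 2 * gam * rho ^+ 2 * (gam + 2 * beta) + 8 * L ^+ 2) / (2 * mu * gam * rho ^+ 2).
Definition kappa_const (mu gam : R) : R := mu * gam / 2.

End Defs.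

Arguments upd {R N d} p i x.

Section Prob.
Variables (R : realType) (dO : measure_display) (Omega : measurableType dO).

Definition feedback_sigma N (d : 'I_N -> nat)
  (fb : nat -> forall i : 'I_N, Omega -> 'rV[R]_(d i)) (t : nat) : set (set Omega) :=
  <<s [set A | exists s (i : 'I_N) (j : 'I_(d i)) (B : set R),
        [/\ (s < t)%N, measurable B & A = (fun w => fb s i w ord0 j) @^-1` B] ] >>.

End Prob.

(* Main.v *)
(* Write D_t for the Bregman divergence from the equilibrium to the iterate pi^t and
   a_t = kappa t + 2 theta = 1 / eta_t.  The three-point identity for the mirror step,
   monotonicity of the game, Assumption A and Young's inequality give, pathwise,
     a_t D_(t+1) <= (a_t - 2 kappa) D_t + sum_i <xi_i^t, pi_i^t - pi_i^(mu,sigma)>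
                    + |xi^t|^2 / (rho a_t),
   where 2 theta is large enough to absorb the terms in D(pi^(t+1), pi^t).  Since
   a_t - 2 kappa <= a_(t-1), this telescopes before any expectation is taken, so that
   the divergences themselves never have to be shown measurable.  In expectation the
   inner products vanish, because pi^t is bounded and F_t-measurable, and
   sum_s 1 / a_s is compared with a logarithm. *)
Require Import Defs.
From HB Require Import structures.
From mathcomp Require Import all_boot all_order all_algebra.
From mathcomp Require Import all_classical all_reals all_analysis.
From mathcomp Require Import measurable_realfun ring lra.
Import Order.TTheory GRing.Theory Num.Theory.
Import numFieldNormedType.Exports.
Local Open Scope ring_scope.
Local Open Scope classical_set_scope.
Set Implicit Arguments.
Unset Strict Implicit.

(** * Euclidean inner product and Young's inequality *)

Section InnerProduct.
Variables (R : realType) (n : nat).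
Implicit Types (x y z : 'rV[R]_n) (c : R).

Lemma dotvC x y : dotv x y = dotv y x.
Proof. by apply: eq_bigr => j _; rewrite mulrC. Qed.

Lemma dotvDl x y z : dotv (x + y) z = dotv x z + dotv y z.
Proof. by rewrite /dotv -big_split; apply: eq_bigr => j _; rewrite mxE mulrDl. Qed.

Lemma dotvZl c x y : dotv (c *: x) y = c * dotv x y.
Proof. by rewrite /dotv mulr_sumr; apply: eq_bigr => j _; rewrite mxE mulrA. Qed.

Lemma dotvNl x y : dotv (- x) y = - dotv x y.
Proof. by rewrite -scaleN1r dotvZl mulN1r. Qed.

Lemma dotvBl x y z : dotv (x - y) z = dotv x z - dotv y z.
Proof. by rewrite dotvDl dotvNl. Qed.

Lemma dotvDr x y z : dotv x (y + z) = dotv x y + dotv x z.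
Proof. by rewrite dotvC dotvDl !(dotvC x). Qed.

Lemma dotvZr c x y : dotv x (c *: y) = c * dotv x y.
Proof. by rewrite dotvC dotvZl dotvC. Qed.

Lemma dotvBr x y z : dotv x (y - z) = dotv x y - dotv x z.
Proof. by rewrite dotvC dotvBl !(dotvC x). Qed.

Lemma sqn_ge0 x : 0 <= sqn x.
Proof. by apply: sumr_ge0 => j _; rewrite -expr2 sqr_ge0. Qed.

Lemma sqnZ c x : sqn (c *: x) = c ^+ 2 * sqn x.
Proof. by rewrite /sqn dotvZl dotvZr mulrA -expr2. Qed.

Lemma sqn_distC x y : sqn (x - y) = sqn (y - x).
Proof. by rewrite -opprB -scaleN1r sqnZ sqrrN expr1n mul1r. Qed.

Lemma enormZ c x : enorm (c *: x) = `|c| * enorm x.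
Proof. by rewrite /enorm sqnZ sqrtrM ?sqr_ge0 // sqrtr_sqr. Qed.

(** Expand [0 <= sqn (c *: x - y)] and divide by [2 * c]. *)
Lemma dotv_young c x y : 0 < c ->
  dotv x y <= c / 2 * sqn x + sqn y / (2 * c).
Proof.
move=> c0; have := sqn_ge0 (c *: x - y).
rewrite /sqn !(dotvBl, dotvBr) !(dotvZl, dotvZr) (dotvC y x) => h.
have -> : c / 2 * dotv x x + dotv y y / (2 * c) =
  dotv x y + (c * (c * dotv x x) - c * dotv x y - (c * dotv x y - dotv y y)) / (2 * c).
  by field; lra.
by rewrite lerDl divr_ge0 //; lra.
Qed.

End InnerProduct.

(** * One-sided derivatives and first-order conditions *)

Section RightSlope.
Variable R : realType.
Implicit Types (f g : R -> R) (a b c D E : R).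

(** Right derivative at [0] of a function normalized to vanish there. One side suffices, since from
    a point of a convex set only segments into the set are followed. *)
Definition right_slope f D := forall e : R, 0 < e ->
  exists2 del : R, 0 < del & forall l, 0 < l < del -> `|f l - l * D| <= e * l.

(** Divide by [l] and let [l] tend to [0]. The slack [l ^+ 2 * c] accommodates the quadratic term of
    strong convexity. *)
Lemma right_slope_le f D b c : right_slope f D ->
  (forall l, 0 < l <= 1 -> f l <= l * b + l ^+ 2 * c) -> D <= b.
Proof.
move=> fD fb; rewrite leNgt; apply/negP => bD.
pose e := (D - b) / 4; have e0 : 0 < e by rewrite /e; lra.
have [del del0 /= hdel] := fD e e0.
have c1 : 0 < `|c| + 1 by rewrite ltr_wpDl.
(* The three bounds make the hypothesis on [f] and the slope estimate both available at [l] and give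
   [l * c <= e]; then [D - b <= 2 * e], against [D - b = 4 * e]. *)
pose l := Num.min 1 (Num.min (del / 2) (e / (`|c| + 1))).
have l0 : 0 < l by rewrite !lt_min ltr01 /=; apply/andP; split; apply: divr_gt0.
have l1 : l <= 1 by rewrite ge_min lexx.
have ldel : l < del.
  apply: (@le_lt_trans _ _ (del / 2)); last by lra.
  by rewrite !ge_min lexx orbT.
have lc : l * c <= e.
  apply: (@le_trans _ _ (l * (`|c| + 1))).
    by rewrite ler_wpM2l ?(ltW l0) // (le_trans (ler_norm c)) // lerDl.
  by rewrite -ler_pdivlMr // !ge_min lexx !orbT.
have := hdel l; rewrite l0 ldel => /(_ isT); rewrite ler_norml => /andP[h _].
have := fb l; rewrite l0 l1 => /(_ isT) h2.
have : l * (D - b - e) <= l * (l * c) by nra.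
rewrite ler_pM2l // => h3; have : 4 * e = D - b by rewrite /e; field.
lra.
Qed.

Lemma right_slope_lin f g D E a b : right_slope f D -> right_slope g E ->
  right_slope (fun l => a * f l + b * g l) (a * D + b * E).
Proof.
move=> fD gE e e0.
have k0 : 0 < `|a| + `|b| + 1 by rewrite ltr_wpDl // addr_ge0.
have e'0 : 0 < e / (`|a| + `|b| + 1) by rewrite divr_gt0.
have [d1 d10 h1] := fD _ e'0; have [d2 d20 h2] := gE _ e'0.
exists (Num.min d1 d2); first by rewrite lt_min d10.
move=> l /andP[l0]; rewrite lt_min => /andP[l1 l2].
have := h1 l; rewrite l0 l1 => /(_ isT) {}h1.
have := h2 l; rewrite l0 l2 => /(_ isT) {}h2.
have -> : a * f l + b * g l - l * (a * D + b * E) =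
  a * (f l - l * D) + b * (g l - l * E) by ring.
apply: (le_trans (ler_normD _ _)); rewrite !normrM.
apply: (@le_trans _ _ ((`|a| + `|b|) * (e / (`|a| + `|b| + 1) * l))).
  by rewrite mulrDl lerD // ler_wpM2l.
have -> : e * l = (`|a| + `|b| + 1) * (e / (`|a| + `|b| + 1) * l).
  by field; rewrite gt_eqF.
by rewrite ler_wpM2r ?lerDl // mulr_ge0 ?(ltW e'0) ?(ltW l0).
Qed.

Lemma has_grad_slope n (f : 'rV[R]_n -> R) (g x u : 'rV[R]_n) :
  has_grad f g x -> right_slope (fun l => f (x + l *: u) - f x) (dotv g u).
Proof.
(* The added [1] keeps the divisor positive when [u = 0]. *)
move=> fg e e0; have u1 : 0 < enorm u + 1 by rewrite ltr_wpDl // sqrtr_ge0.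
have [del del0 h] := fg (e / (enorm u + 1)) (divr_gt0 e0 u1).
exists (del / (enorm u + 1)); first by rewrite divr_gt0.
move=> l /andP[l0]; rewrite ltr_pdivlMr // => ldel.
have := h (x + l *: u); rewrite (addrC x) addrK enormZ gtr0_norm // dotvZr.
have lu : l * enorm u <= l * (enorm u + 1) by rewrite ler_pM2l // lerDl.
move=> /(_ (le_lt_trans lu ldel)) /le_trans; apply.
rewrite mulrA [leRHS]mulrC [e / _ * l]mulrC -!mulrA ler_pM2l // ler_piMr ?(ltW e0) //.
by rewrite mulrC ler_pdivrMr // mul1r lerDl.
Qed.

End RightSlope.

(** * Unilateral deviations from a profile *)

Section Profiles.
Variables (R : realType) (N : nat) (d : 'I_N -> nat).
Implicit Types p q : prof R d.

Lemma upd_same p i x : upd p i x i = x.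
(* The cast is along a proof of [i = i], which is trivial because equality on ['I_N] is
   decidable. *)
Proof. by rewrite /upd; case: eqP => // e; rewrite (eq_axiomK e). Qed.

Lemma upd_other p i x j : i != j -> upd p i x j = p j.
Proof. by rewrite /upd; case: eqP. Qed.

(** When only block [i] moves, every other block contributes zero to both the norm and the
    differential. *)
Lemma prof_diff_slope (f : prof R d -> R) (D p : prof R d) i (u : 'rV[R]_(d i)) :
  prof_diff f D p ->
  right_slope (fun l => f (upd p i (p i + l *: u)) - f p) (dotv (D i) u).
Proof.
move=> fD e e0; have u1 : 0 < enorm u + 1 by rewrite ltr_wpDl // sqrtr_ge0.
have [del del0 h] := fD (e / (enorm u + 1)) (divr_gt0 e0 u1).
exists (del / (enorm u + 1)); first by rewrite divr_gt0.
move=> l /andP[l0]; rewrite ltr_pdivlMr // => ldel.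
set q := upd p i (p i + l *: u).
have qi : q i - p i = l *: u by rewrite /q upd_same (addrC (p i)) addrK.
have qj j : j != i -> q j - p j = 0.
  by move=> ji; rewrite /q upd_other 1?eq_sym // subrr.
have nq : enormp (subp q p) = l * enorm u.
  rewrite /enormp /sqnp (bigD1 i) //= /subp qi big1 ?addr0.
    by rewrite -/(enorm _) enormZ gtr0_norm.
  by move=> j ji; rewrite qj // /sqn /dotv big1 // => k _; rewrite mxE mul0r.
have := h q; rewrite nq (bigD1 i) //= big1 => [|j ji]; last first.
  by rewrite qj // /dotv big1 // => k _; rewrite mxE mulr0.
rewrite qi dotvZr addr0.
have lu : l * enorm u <= l * (enorm u + 1) by rewrite ler_pM2l // lerDl.
move=> /(_ (le_lt_trans lu ldel)) /le_trans; apply.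
rewrite mulrA [leRHS]mulrC [e / _ * l]mulrC -!mulrA ler_pM2l // ler_piMr ?(ltW e0) //.
by rewrite mulrC ler_pdivrMr // mul1r lerDl.
Qed.

End Profiles.

(** * Bregman divergences and the mirror step *)

Section Bregman.
Variables (R : realType) (n : nat) (X : set 'rV[R]_n).
Variables (psi : 'rV[R]_n -> R) (gpsi : 'rV[R]_n -> 'rV[R]_n).
Implicit Types x y p q : 'rV[R]_n.

Lemma convex_segment x y (l : R) : convex_rv X -> X x -> X y -> 0 < l <= 1 ->
  X (x + l *: (y - x)).
Proof.
move=> cX Xx Xy /andP[l0 l1]; have -> : x + l *: (y - x) = l *: y + (1 - l) *: x.
  by rewrite scalerBr scalerBl scale1r addrCA.
by apply: cX; rewrite // (ltW l0).
Qed.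

Lemma bregman_three_point x p q :
  bregman psi gpsi x q - bregman psi gpsi x p + bregman psi gpsi q p =
  dotv (gpsi p - gpsi q) (x - q).
Proof. by rewrite /bregman !(dotvBl, dotvBr); ring. Qed.

Hypothesis psi_grad : forall x, X x -> has_grad psi (gpsi x) x.

(** Strong convexity on the segment from [x] to [y] bounds the increment of [psi] by a linear term
    in [l] plus a multiple of [l ^+ 2]; comparing slopes at [l = 0] gives the claim. *)
Lemma bregman_ge_sqn (rho : R) x y : strongly_convex_on rho X psi ->
  X x -> X y -> rho / 2 * sqn (y - x) <= bregman psi gpsi y x.
Proof.
move=> sc Xx Xy; rewrite /bregman lerBrDr addrC -lerBrDr.
apply: (right_slope_le (has_grad_slope (y - x) (psi_grad Xx))
  (c := rho / 2 * sqn (y - x))) => l /andP[l0 l1].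
have := sc y x l Xy Xx; rewrite (ltW l0) l1 => /(_ isT).
have -> : l *: y + (1 - l) *: x = x + l *: (y - x).
  by rewrite scalerBr scalerBl scale1r addrCA.
lra.
Qed.

(** First-order condition for the maximizer [q] along the segment towards [x], rewritten by the
    three-point identity. *)
Lemma mirror_step_optimality (c : R) (g x p q : 'rV[R]_n) : convex_rv X ->
  X q -> X x ->
  (forall y, X y -> c * dotv g y - bregman psi gpsi y p <=
                    c * dotv g q - bregman psi gpsi q p) ->
  bregman psi gpsi x q - bregman psi gpsi x p + bregman psi gpsi q p <=
  c * dotv g (q - x).
Proof.
move=> cX Xq Xx opt; rewrite bregman_three_point.
(* The required bound on the slope of [psi] is a lower one, so it is read off from [- psi]; the
   weight [0] blanks the second summand. *)
have slope := right_slope_lin (-1) 0 (has_grad_slope (x - q) (psi_grad Xq))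
                         (has_grad_slope (x - q) (psi_grad Xq)).
have := right_slope_le (b := - (c * dotv g (x - q) + dotv (gpsi p) (x - q)))
          (c := 0) slope.
suff h l : 0 < l <= 1 -> -1 * (psi (q + l *: (x - q)) - psi q) +
    0 * (psi (q + l *: (x - q)) - psi q) <=
    l * - (c * dotv g (x - q) + dotv (gpsi p) (x - q)) + l ^+ 2 * 0.
  by move=> /(_ h); rewrite !(dotvBl, dotvBr); lra.
move=> l1; have := opt _ (convex_segment cX Xq Xx l1).
rewrite /bregman !(dotvBr, dotvDr, dotvZr); lra.
Qed.

End Bregman.

(** * One step of the dynamics, for a single player and for the profile *)

Section Game.
Unset Implicit Arguments.
Variables (R : realType) (N : nat) (d : 'I_N -> nat).
Variables (X : forall i : 'I_N, set 'rV[R]_(d i)).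
Variables (v : 'I_N -> prof R d -> R) (gv : forall i : 'I_N, prof R d -> 'rV[R]_(d i)).
Variables (psi : forall i : 'I_N, 'rV[R]_(d i) -> R).
Variables (gpsi : forall i : 'I_N, 'rV[R]_(d i) -> 'rV[R]_(d i)).
Variables (G : forall i : 'I_N, 'rV[R]_(d i) -> 'rV[R]_(d i) -> R).
Variables (gG : forall i : 'I_N, 'rV[R]_(d i) -> 'rV[R]_(d i) -> 'rV[R]_(d i)).
Variables (L rho beta gam mu : R) (sigma pmu : prof R d).
Set Implicit Arguments.
Hypothesis Xconvex : forall i, convex_rv (X i).
Hypothesis v_diff : forall i p, in_prof X p ->
  exists D : prof R d, prof_diff (v i) D p /\ D i = gv i p.
Hypothesis monotone : forall p q, in_prof X p -> in_prof X q ->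
  \sum_(i < N) dotv (gv i p - gv i q) (p i - q i) <= 0.
Hypothesis smooth : forall p q, in_prof X p -> in_prof X q ->
  \sum_(i < N) sqn (gv i p - gv i q) <= L ^+ 2 * sqnp (subp p q).
Hypothesis rho_gt0 : 0 < rho.
Hypothesis psi_grad : forall i x, X i x -> has_grad (psi i) (gpsi i x) x.
Hypothesis psi_convex : forall i, strongly_convex_on rho (X i) (psi i).
Hypothesis G_grad : forall i x s, X i x -> X i s ->
  has_grad (fun y => G i y s) (gG i x s) x.
Hypothesis beta_gt0 : 0 < beta.
Hypothesis gam_gt0 : 0 < gam.
Hypothesis G_rel : forall i s p p', X i s -> X i p -> X i p' ->
  gam * bregman (psi i) (gpsi i) p' p <= G i p' s - G i p s - dotv (gG i p s) (p' - p)
  /\ G i p' s - G i p s - dotv (gG i p s) (p' - p) <= beta * bregman (psi i) (gpsi i) p' p.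
Hypothesis mu_gt0 : 0 < mu.
Hypothesis Xsigma : in_prof X sigma.
Hypothesis Xpmu : in_prof X pmu.
Hypothesis equilibrium : forall i x, X i x ->
  v i (upd pmu i x) - mu * G i x (sigma i) <= v i pmu - mu * G i (pmu i) (sigma i).

(** First-order condition for the best response of player [i], along the segment from [pmu i] to
    [x]. *)
Lemma equilibrium_optimality i x : X i x ->
  dotv (gv i pmu) (x - pmu i) <= mu * dotv (gG i (pmu i) (sigma i)) (x - pmu i).
Proof.
move=> Xx; have [D [vD <-]] := v_diff i Xpmu.
have := right_slope_lin 1 (- mu) (prof_diff_slope (x - pmu i) vD)
  (has_grad_slope (x - pmu i) (G_grad (Xpmu i) (Xsigma i))).
move=> /(right_slope_le (b := 0) (c := 0)) H.
rewrite -subr_le0 -mulNr -[X in X + _]mul1r; apply: H => l l1.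
have := equilibrium (convex_segment (@Xconvex i) (Xpmu i) Xx l1).
lra.
Qed.

Local Notation breg i := (bregman (psi i) (gpsi i)).

Lemma breg_ge0 i x y : X i x -> X i y -> 0 <= breg i x y.
Proof.
move=> Xx Xy; apply: le_trans (bregman_ge_sqn (@psi_grad i) (@psi_convex i) Xy Xx).
by rewrite mulr_ge0 ?sqn_ge0 // divr_ge0 // ltW.
Qed.

Lemma bregp_ge0 p q : in_prof X p -> in_prof X q -> 0 <= bregp psi gpsi p q.
Proof. by move=> Xp Xq; apply: sumr_ge0 => i _; apply: breg_ge0. Qed.

(** The mirror-step inequality is tested at [pmu i], with learning rate [1 / a]. The payoff gradient
    is split at [q] and at the equilibrium, the noise at [p], so that the linear noise term pairs
    [z] with a quantity fixed before [z] is drawn. *)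
Lemma player_step_descent i (a : R) (p q : prof R d) (z : 'rV[R]_(d i)) : 0 < a ->
  in_prof X p -> in_prof X q ->
  (forall x, X i x ->
     (1 / a) * dotv (gv i p + z - mu *: gG i (p i) (sigma i)) x - breg i x (p i) <=
     (1 / a) * dotv (gv i p + z - mu *: gG i (p i) (sigma i)) (q i) - breg i (q i) (p i)) ->
  a * breg i (pmu i) (q i) <=
    (a - mu * gam) * breg i (pmu i) (p i) + (mu * beta - a / 2) * breg i (q i) (p i)
    + (2 * (mu * gam * rho))^-1 * sqn (gv i p - gv i q)
    + dotv (gv i q - gv i pmu) (q i - pmu i)
    + dotv z (p i - pmu i) + (rho * a)^-1 * sqn z.
Proof.
move=> a0 Xp Xq opt.
have := mirror_step_optimality (@psi_grad i) (@Xconvex i) (Xq i) (Xpmu i) opt.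
rewrite mul1r mulrC ler_pdivlMr // => step.
have eqm := equilibrium_optimality (Xq i).
(* In the sum of these three bounds the values of [G] cancel, which leaves only divergences. *)
have [rel1 _] := G_rel (Xsigma i) (Xpmu i) (Xq i).
have [rel2 _] := G_rel (Xsigma i) (Xp i) (Xpmu i).
have [_ rel3] := G_rel (Xsigma i) (Xp i) (Xq i).
have sc1 := bregman_ge_sqn (@psi_grad i) (@psi_convex i) (Xpmu i) (Xq i).
have sc2 := bregman_ge_sqn (@psi_grad i) (@psi_convex i) (Xp i) (Xq i).
have k0 : 0 < mu * gam by rewrite mulr_gt0.
(* The Young weight is chosen so that the resulting [mu * gam * breg i (q i) (pmu i)] is exactly
   what [rel1] supplies with the opposite sign. *)
have yg : dotv (gv i p - gv i q) (q i - pmu i) <=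
  (2 * (mu * gam * rho))^-1 * sqn (gv i p - gv i q)
  + mu * gam * breg i (q i) (pmu i).
  have c0 : 0 < (mu * gam * rho)^-1 by rewrite invr_gt0 mulr_gt0.
  apply: (le_trans (dotv_young _ _ c0)); rewrite -subr_ge0.
  have -> : (2 * (mu * gam * rho))^-1 * sqn (gv i p - gv i q) +
    mu * gam * breg i (q i) (pmu i) - ((mu * gam * rho)^-1 / 2 * sqn (gv i p - gv i q) +
    sqn (q i - pmu i) / (2 * (mu * gam * rho)^-1)) =
    mu * gam * (breg i (q i) (pmu i) - rho / 2 * sqn (q i - pmu i)).
    by field; rewrite !gt_eqF.
  by rewrite mulr_ge0 ?(ltW k0) // subr_ge0.
(* The weight spends half of the term [- a * breg i (q i) (p i)] from the mirror step. *)
have yz : dotv z (q i - p i) <= (rho * a)^-1 * sqn z + a / 2 * breg i (q i) (p i).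
  have c0 : 0 < 2 / (rho * a) by rewrite divr_gt0 ?mulr_gt0.
  apply: (le_trans (dotv_young _ _ c0)); rewrite -subr_ge0.
  have -> : (rho * a)^-1 * sqn z + a / 2 * breg i (q i) (p i) -
    (2 / (rho * a) / 2 * sqn z + sqn (q i - p i) / (2 * (2 / (rho * a)))) =
    a / 2 * (breg i (q i) (p i) - rho / 2 * sqn (q i - p i)).
    by field; rewrite !gt_eqF.
  by rewrite mulr_ge0 ?subr_ge0 // divr_ge0 // ltW.
have split : dotv (gv i p + z - mu *: gG i (p i) (sigma i)) (q i - pmu i) =
    dotv (gv i p - gv i q) (q i - pmu i) + dotv (gv i q - gv i pmu) (q i - pmu i)
    + dotv (gv i pmu) (q i - pmu i) + dotv z (q i - p i) + dotv z (p i - pmu i)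
    - mu * (dotv (gG i (p i) (sigma i)) (q i - p i)
            - dotv (gG i (p i) (sigma i)) (pmu i - p i)).
  by rewrite !(dotvDl, dotvNl, dotvZl) !dotvBr; ring.
move: rel1 rel2 rel3 => /(ler_wpM2l (ltW mu_gt0)) rel1 /(ler_wpM2l (ltW mu_gt0)) rel2
  /(ler_wpM2l (ltW mu_gt0)).
move: rel1 rel2 step eqm yg yz; rewrite split.
move: (breg i _ _) (breg i _ _) (breg i _ _) (breg i _ _) => b1 b2 b3 b4.
do 8! move: (dotv _ _) => ?.
move: (_ * sqn _) (_ * sqn _) (G i _ _) (G i _ _) (G i _ _) => s1 s2 g1 g2 g3.
lra.
Qed.

(** After summation over the players, monotonicity discards the cross term. Smoothness and strong
    convexity bound the gradient differences by [K] times the divergence from [p] to [q]. *)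
Lemma step_descent (a : R) (p q z : prof R d) :
  2 * theta_const mu gam rho beta L <= a ->
  in_prof X p -> in_prof X q ->
  (forall i x, X i x ->
     (1 / a) * dotv (gv i p + z i - mu *: gG i (p i) (sigma i)) x - breg i x (p i) <=
     (1 / a) * dotv (gv i p + z i - mu *: gG i (p i) (sigma i)) (q i) - breg i (q i) (p i)) ->
  a * bregp psi gpsi pmu q <=
    (a - 2 * kappa_const mu gam) * bregp psi gpsi pmu p
    + \sum_(i < N) dotv (z i) (p i - pmu i) + (rho * a)^-1 * sqnp z.
Proof.
move=> ta Xp Xq opt.
pose K := L ^+ 2 / (mu * gam * rho ^+ 2).
have thetaE : 2 * theta_const mu gam rho beta L = mu * gam + 2 * mu * beta + 8 * K.
  by rewrite /theta_const /K; field; rewrite !gt_eqF.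
have K0 : 0 <= K by rewrite divr_ge0 ?sqr_ge0 // !mulr_ge0 ?ltW ?exprn_gt0.
have mg0 : 0 < mu * gam by rewrite mulr_gt0.
have mb0 : 0 < mu * beta by rewrite mulr_gt0.
have a0 : 0 < a by lra.
have : \sum_(i < N) a * breg i (pmu i) (q i) <= \sum_(i < N)
   ((a - mu * gam) * breg i (pmu i) (p i) + (mu * beta - a / 2) * breg i (q i) (p i)
    + (2 * (mu * gam * rho))^-1 * sqn (gv i p - gv i q)
    + dotv (gv i q - gv i pmu) (q i - pmu i)
    + dotv (z i) (p i - pmu i) + (rho * a)^-1 * sqn (z i)).
  by apply: ler_sum => i _; exact: (player_step_descent a0 Xp Xq (opt i)).
rewrite !big_split /= -!mulr_sumr -!/(bregp psi gpsi _ _) -/(sqnp z).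
have -> : 2 * kappa_const mu gam = mu * gam by rewrite /kappa_const; field.
move=> /le_trans; apply.
have Q0 := bregp_ge0 Xq Xp.
have mono := monotone Xq Xpmu.
have gvle : (2 * (mu * gam * rho))^-1 * \sum_(i < N) sqn (gv i p - gv i q) <=
    K * bregp psi gpsi q p.
  have -> : K = (2 * (mu * gam * rho))^-1 * (L ^+ 2 * (2 / rho)).
    by rewrite /K; field; rewrite !gt_eqF.
  rewrite -[leRHS]mulrA ler_wpM2l //; first by rewrite invr_ge0 !mulr_ge0 // ltW.
  apply: (le_trans (smooth Xp Xq)); rewrite -[leRHS]mulrA ler_wpM2l ?sqr_ge0 //.
  rewrite /sqnp /bregp mulr_sumr; apply: ler_sum => i _; rewrite /subp sqn_distC.
  have r0 : 0 <= 2 / rho by rewrite divr_ge0 // ltW.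
  apply: le_trans (ler_wpM2l r0 (bregman_ge_sqn (@psi_grad i) (@psi_convex i) (Xp i) (Xq i))).
  rewrite mulrA; have -> : 2 / rho * (rho / 2) = 1 by field; rewrite gt_eqF.
  by rewrite mul1r.
(* By [thetaE], [a / 2] is at least [mu * gam / 2 + mu * beta + 4 * K]. *)
have : (mu * beta - a / 2 + K) * bregp psi gpsi q p <= 0.
  by rewrite mulr_le0_ge0 //; lra.
lra.
Qed.

End Game.

(** * Measurability through coordinates and monotonicity of the integral *)

Section Probability.
Context (R : realType) (dT : measure_display) (T : measurableType dT).

(* Each set [F > a] is the union of the countably many grid cells
   [floor (m h_j) = k_j for all j] that it contains. *)
Lemma measurable_fun_coord_continuous (J : finType) (h : J -> T -> R) (F : T -> R) :
  (forall j, measurable_fun setT (h j)) ->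
  (forall w (e : R), 0 < e -> exists2 del : R, 0 < del &
     forall w', (forall j, `|h j w' - h j w| < del) -> `|F w' - F w| < e) ->
  measurable_fun setT F.
Proof.
move=> mh cF mD; apply: (measurability _ (RGenOInfty.measurableE R)) => //.
move=> _ [_ [a ->] <-]; rewrite setTI.
pose cell (m : nat * {ffun J -> int}) : set T :=
  [set w | forall j, Num.floor (m.1.+1%:R * h j w) = m.2 j].
have mcell m : measurable (cell m).
  have -> : cell m = \bigcap_(j in [set: J])
      (fun w => m.1.+1%:R * h j w) @^-1` `[(m.2 j)%:~R, (m.2 j + 1)%:~R[%classic.
    apply/seteqP; split => w /= H j.
      move=> _ /=; rewrite in_itv /= -H; apply/andP; split.
        by rewrite floor_le.
      by rewrite floorD1_gt.
    by have /= := H j Logic.I; rewrite in_itv /= => H1; apply: floor_def.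
  apply: fin_bigcap_measurable => // j _.
  rewrite -[X in measurable X]setTI.
  by apply: measurable_funM => //; exact: measurable_itv.
pose good := [set m | cell m `<=` F @^-1` `]a, +oo[%classic].
have -> : F @^-1` `]a, +oo[%classic =
    \bigcup_(m in [set: nat * {ffun J -> int}]) if m \in good then cell m else set0.
  apply/seteqP; split => w /=; last first.
    by move=> [m _]; case: ifPn => //; rewrite inE; apply.
  rewrite in_itv /= andbT => aF.
  (* On a cell of mesh below [del], [F] differs from [F w] by less than [F w - a], hence stays above
     [a]. *)
  have [|del del0 hdel] := cF w (F w - a); first by rewrite subr_gt0.
  have idel0 : 0 <= del^-1 by rewrite invr_ge0 ltW.
  pose n := Num.bound del^-1.
  have n1 : 0 < n.+1%:R :> R by rewrite ltr0n.
  have ndel : n.+1%:R^-1 < del.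
    rewrite invf_plt ?posrE //; apply: (lt_trans (archi_boundP idel0)).
    by rewrite ltr_nat.
  pose k := (n, [ffun j => Num.floor (n.+1%:R * h j w)] : {ffun J -> int}).
  exists k => //; have wk : cell k w by move=> j; rewrite ffunE.
  rewrite ifT // inE /good => w' /= wk'; rewrite in_itv /= andbT.
  suff : `|F w' - F w| < F w - a by rewrite ltr_norml; lra.
  apply: hdel => j; apply: le_lt_trans ndel.
  have := wk' j; rewrite /= ffunE => fl.
  have := floor_le (n.+1%:R * h j w); have := floorD1_gt (n.+1%:R * h j w).
  have := floor_le (n.+1%:R * h j w'); have := floorD1_gt (n.+1%:R * h j w').
  rewrite fl intrD => h1 h2 h3 h4.
  rewrite -(ler_pM2l n1) divff ?gt_eqF // -[X in X * _](gtr0_norm n1) -normrM.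
  by rewrite ler_norml mulrBr; lra.
apply: countable_bigcupT_measurable => // m.
by case: ifP.
Qed.

(* Unlike ge0_le_integral, f and g need not be measurable: the integral of a
   nonnegative function is a supremum over the simple functions below it. *)
Lemma ge0_le_integralT (mu : {measure set T -> \bar R}) (f g : T -> \bar R) :
  (forall w, 0 <= f w)%E -> (forall w, f w <= g w)%E ->
  (\int[mu]_w f w <= \int[mu]_w g w)%E.
Proof.
move=> f0 fg; rewrite !ge0_integralTE //; last first.
  by move=> w; apply: le_trans (fg w).
apply: le_ereal_sup => _ [k kf <-]; exists k => // w.
exact: le_trans (kf w) (fg w).
Qed.

End Probability.

(** * Orthogonality of the noise and upper bounds on expectations *)

Section Expectation.
Local Open Scope ereal_scope.
Context (R : realType) (dT : measure_display) (T : measurableType dT).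
Variable P : probability T R.

(** Measurability is asked only of feedback before [t], so that the lemma can serve inside an
    induction on time. *)
Lemma feedback_sigma_measurable N (d : 'I_N -> nat)
    (fb : nat -> forall i : 'I_N, T -> 'rV[R]_(d i)) t :
  (forall s i j, (s < t)%N -> measurable_fun setT (fun w => fb s i w ord0 j)) ->
  feedback_sigma fb t `<=` measurable.
Proof.
move=> mfb; apply: smallest_sub; first exact: sigma_algebra_measurable.
move=> _ [s [i [j [B [st mB ->]]]]].
by rewrite -[X in measurable X]setTI; exact: mfb.
Qed.

(* Rounding f down to multiples of 1/(n+1) leaves a finite combination of
   indicators of Sigma-sets, against which x integrates to 0; the error is at most
   E|x|/(n+1). *)
Lemma integral_mul_orthogonal (Sigma : set (set T)) (f x : T -> R) (M : R) :
  Sigma `<=` measurable ->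
  (forall B, measurable B -> Sigma (f @^-1` B)) ->
  (forall w, `|f w| <= M)%R ->
  P.-integrable setT (EFin \o x) ->
  (forall A, Sigma A -> \int[P]_(w in A) (x w)%:E = 0) ->
  P.-integrable setT (fun w => (f w * x w)%:E) /\ \int[P]_w (f w * x w)%:E = 0.
Proof.
move=> SigM fS fM ix x0.
have mf : measurable_fun setT f by move=> _ B mB; rewrite setTI; exact/SigM/fS.
have mx : measurable_fun setT x by apply/measurable_EFinP; exact: measurable_int ix.
have ifx : P.-integrable setT (fun w => (f w * x w)%:E).
  apply: (le_integrable measurableT _ _ (integrableZl measurableT M ix)).
    by apply/measurable_EFinP; exact: measurable_funM.
  move=> w _ /=; rewrite lee_fin !normrM ler_wpM2r //.
  exact: le_trans (fM w) (ler_norm _).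
split=> //.
have approx n : `|\int[P]_w (f w * x w)%:E| <= (n.+1%:R^-1)%:E * \int[P]_w `|(x w)%:E|.
  (* The shift by [M] makes the argument nonnegative, so truncation is a floor; [K] exceeds every
     index and keeps the combination finite. *)
  pose k w := Num.truncn (n.+1%:R * (f w + M)).
  pose K := (Num.truncn (n.+1%:R * (M + M))).+1.
  have fM0 w : (0 <= n.+1%:R * (f w + M))%R.
    by rewrite mulr_ge0 //; have := fM w; rewrite ler_norml; lra.
  have kK w : (k w < K)%N.
    rewrite ltnS; apply: le_truncn; rewrite ler_wpM2l // lerD2r.
    exact: le_trans (ler_norm _) (fM w).
  pose A j : set T := k @^-1` [set j].
  have SA j : Sigma (A j).
    have -> : A j = f @^-1` ((fun r : R => n.+1%:R * (r + M))%R @^-1`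
        `[j%:R, j.+1%:R[%classic).
      apply/seteqP; split => w /=; rewrite in_itv /= => h; last exact: truncn_def.
      by rewrite -h truncn_itv // fM0.
    apply: fS; rewrite -[X in measurable X]setTI.
    by apply: measurable_funM => //; exact: measurable_funD.
  pose c j : R := (j%:R / n.+1%:R - M)%R.
  pose S j w := (c j)%:E * ((EFin \o x) \_ (A j)) w.
  have ixA j : P.-integrable setT ((EFin \o x) \_ (A j)).
    have mA := SigM _ (SA j).
    exact: (iffLR (integrable_mkcond _ mA) (integrableS measurableT mA (@subsetT _ _) ix)).
  have iS j : P.-integrable setT (S j).
    exact: integrableZl.
  have S0 : \int[P]_w (\sum_(j < K) S j w) = 0.
    rewrite integral_sum // big1 // => j _.
    rewrite integralZl //.
    by rewrite -integral_mkcond x0 ?mule0.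
  have isumS : P.-integrable setT (fun w => \sum_(j < K) S j w) by exact: integrable_sum.
  have SE w : \sum_(j < K) S j w = (c (k w) * x w)%:E.
    rewrite (bigD1 (Ordinal (kK w))) //= big1 ?adde0 => [|j jk].
      by rewrite /S patchE ifT // inE.
    by rewrite /S patchE ifN ?mule0 // notin_setE => /= kj; move/eqP: jk; apply; apply: val_inj.
  have ck w : (`|f w - c (k w)| <= n.+1%:R^-1)%R.
    have n1 : (0 < n.+1%:R :> R)%R by rewrite ltr0n.
    have := truncn_itv (fM0 w); rewrite -/(k w) => /andP[h1 h2].
    rewrite -(ler_pM2l n1) divff ?gt_eqF // -[X in (X * _)%R](gtr0_norm n1) -normrM.
    have -> : (n.+1%:R * (f w - c (k w)) = n.+1%:R * (f w + M) - (k w)%:R)%R.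
      by rewrite /c; field; rewrite gt_eqF.
    by rewrite -natr1 in h2; rewrite ler_norml; lra.
  have -> : \int[P]_w (f w * x w)%:E =
      \int[P]_w ((fun w => (f w * x w)%:E) \- (fun w => \sum_(j < K) S j w)) w.
    by rewrite integralB // S0 sube0.
  have isub := integrableB measurableT ifx isumS.
  apply: (le_trans (le_abse_integral P measurableT (measurable_int P isub))).
  rewrite -ge0_integralZl //; last by apply: measurableT_comp => //; apply/measurable_EFinP.
  apply: ge0_le_integral => //.
  - by apply: measurableT_comp => //; exact: measurable_int isub.
  - by apply: measurable_funeM; apply: measurableT_comp => //; apply/measurable_EFinP.
  - move=> w _ /=; rewrite SE -EFinB lee_fin -mulrBl normrM.
    by rewrite ler_wpM2r.
(* Both integrals are finite, so [approx] for all [n] forces the left one to vanish by the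
   Archimedean property. *)
have := integrable_fin_num measurableT ifx.
have := integrable_fin_num measurableT (integrable_abse ix).
move: approx; rewrite /=.
move: (integral P setT (fun w => `|(x w)%:E|)) (integral P setT (fun w => (f w * x w)%:E)).
move=> [e||] [r||] // approx _ _; congr (_%:E); apply/eqP/negPn/negP => r0.
have r1 : (0 < `|r|)%R by rewrite normr_gt0.
have e0 : (0 <= e)%R.
  have := approx 0%N; rewrite invr1 mul1e lee_fin; exact: le_trans.
have := archi_boundP (divr_ge0 e0 (ltW r1)); set n := Num.bound _.
rewrite ltr_pdivrMr // => h; have := approx n.
rewrite lee_fin mulrC ler_pdivlMr ?ltr0n // => h2.
have : (n%:R * `|r| < n.+1%:R * `|r|)%R by rewrite ltr_pM2r // ltr_nat.
by rewrite [ltRHS]mulrC; move: h h2; lra.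
Qed.

(** Integrability is bundled with the bound because additivity of the integral needs it; the pair is
    then stable under sums and nonnegative scaling. *)
Definition expectation_le (f : T -> R) (c : R) :=
  P.-integrable setT (EFin \o f) /\ \int[P]_w (f w)%:E <= c%:E.

Lemma expectation_le_cst c : expectation_le (fun=> c) c.
Proof.
split; first exact: finite_measure_integrable_cst.
by rewrite integral_cst // -[leRHS]mule1 -(probability_setT P).
Qed.

Lemma expectation_leD f g a b : expectation_le f a -> expectation_le g b ->
  expectation_le (fun w => f w + g w)%R (a + b).
Proof.
move=> [fi fa] [gi gb]; split.
  have -> : EFin \o (fun w => f w + g w)%R = (EFin \o f) \+ (EFin \o g) by [].
  exact: integrableD.
under eq_integral do rewrite EFinD.
by rewrite integralD // EFinD leeD.
Qed.

Lemma expectation_leZ k f a : (0 <= k)%R -> expectation_le f a ->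
  expectation_le (fun w => k * f w)%R (k * a).
Proof.
move=> k0 [fi fa]; split.
  have -> : EFin \o (fun w => k * f w)%R = (fun w => k%:E * (EFin \o f) w) by [].
  exact: integrableZl.
under eq_integral do rewrite EFinM.
by rewrite integralZl // EFinM lee_wpmul2l.
Qed.

Lemma expectation_le_sum (I : Type) (s : seq I) (f : I -> T -> R) (a : I -> R) :
  (forall i, expectation_le (f i) (a i)) ->
  expectation_le (fun w => \sum_(i <- s) f i w)%R (\sum_(i <- s) a i).
Proof.
move=> fa; elim: s => [|i s IH].
  rewrite big_nil; under eq_fun do rewrite big_nil; exact: expectation_le_cst.
rewrite big_cons; under eq_fun do rewrite big_cons; exact: expectation_leD.
Qed.

Lemma expectation_le_ge0 (f : T -> R) (c : R) : measurable_fun setT f ->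
  (forall w, 0 <= f w)%R -> \int[P]_w (f w)%:E <= c%:E -> expectation_le f c.
Proof.
move=> mf f0 fc; split=> //; apply/integrableP; split; first exact/measurable_EFinP.
under eq_integral do rewrite /= ger0_norm //.
exact: le_lt_trans fc (ltry c).
Qed.

End Expectation.

(** * Logarithmic sum, coordinate bounds and measurability of gradients *)

(** Induction on [t]; the summand for [s = 0] is [1 / a]. With consecutive denominators [b] and
    [c = b + k], the inequality [ln (1 - k / c) <= - (k / c)] bounds the new term [1 / c] by the
    increment of the logarithm divided by [k]. *)
Lemma sum_inv_affine_le (R : realType) (k a : R) (t : nat) : 0 < k -> 0 < a ->
  \sum_(s < t.+1) (k * s%:R + a)^-1 <= 1 / k * ln (k / a * t%:R + 1) + 1 / a.
Proof.
move=> k0 a0; elim: t => [|t IH].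
  by rewrite big_ord_recl big_ord0 !mulr0 !add0r addr0 ln1 mulr0 add0r mul1r.
rewrite big_ord_recr /=.
have b0 : 0 < k * t%:R + a by rewrite ltr_wpDl // mulr_ge0 // ltW.
have c0 : 0 < k * t.+1%:R + a by rewrite ltr_wpDl // mulr_ge0 // ltW.
have E (s : nat) : k / a * s%:R + 1 = (k * s%:R + a) / a by field; rewrite gt_eqF.
move: b0 c0 E; set b := _ * t%:R + a; set c := _ * t.+1%:R + a => b0 c0 E.
have cE : c = b + k by rewrite /c /b -natr1; ring.
have lnb : ln (b / a) <= ln (c / a) - k / c.
  have -> : b / a = (c / a) * (b / c) by field; rewrite !gt_eqF.
  rewrite lnM ?posrE ?divr_gt0 // lerD2l.
  have -> : b / c = 1 + (- (k / c)) by rewrite cE; field; rewrite -cE gt_eqF.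
  apply: le_ln1Dx; rewrite ltrN2 ltr_pdivrMr // mul1r; lra.
rewrite E -/c; apply: (le_trans (lerD IH (lexx _))).
rewrite E -/b addrAC lerD2r.
apply: (@le_trans _ _ (1 / k * (ln (c / a) - k / c) + c^-1)).
  by rewrite lerD2r ler_pM2l // divr_gt0.
by rewrite le_eqVlt; apply/orP; left; apply/eqP; field; rewrite !gt_eqF.
Qed.

Lemma compact_coord_bounded (R : realType) (n : nat) (X : set 'rV[R]_n) (j : 'I_n) :
  compact X -> exists M : R, forall x, X x -> `|x ord0 j| <= M.
Proof.
move=> cX; have : compact ((fun x : 'rV[R]_n => x ord0 j) @` X).
  apply: continuous_compact => //; apply: continuous_subspaceT.
  exact: coord_continuous.
move=> /compact_bounded [M [_ HM]]; exists (M + 1) => x Xx.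
by apply: (HM (M + 1)); [rewrite ltrDl | exists x].
Qed.

Lemma sqr_coord_le_sqn (R : realType) (n : nat) (x : 'rV[R]_n) (j : 'I_n) :
  x ord0 j ^+ 2 <= sqn x.
Proof.
rewrite /sqn /dotv (bigD1 j) //= -expr2 lerDl.
by apply: sumr_ge0 => k _; rewrite -expr2 sqr_ge0.
Qed.

(** Smoothness makes [g] Lipschitz on the strategy profiles, where [p] takes its values, so each
    coordinate of [g] along [p] depends continuously on the coordinates of [p]. *)
Lemma smooth_gradient_measurable (R : realType) (dT : measure_display)
    (T : measurableType dT) (N : nat) (d : 'I_N -> nat)
    (X : forall i : 'I_N, set 'rV[R]_(d i))
    (g : forall i : 'I_N, prof R d -> 'rV[R]_(d i)) (L : R) (p : T -> prof R d) :
  (forall q r, in_prof X q -> in_prof X r ->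
     \sum_(i < N) sqn (g i q - g i r) <= L ^+ 2 * sqnp (subp q r)) ->
  (forall w, in_prof X (p w)) ->
  (forall i j, measurable_fun setT (fun w => p w i ord0 j)) ->
  forall i j, measurable_fun setT (fun w => g i (p w) ord0 j).
Proof.
move=> smooth Xp mp i j; pose J : finType := {i : 'I_N & 'I_(d i)}.
apply: (@measurable_fun_coord_continuous _ _ _ J
  (fun k w => p w (tag k) ord0 (tagged k))) => [k|w e e0]; first exact: mp.
(* Chosen so that [L ^+ 2 * #|J|%:R < c <= c ^+ 2], also when [L] or [#|J|] is zero. *)
pose c : R := (L ^+ 2 + 1) * (#|J|%:R + 1).
have J0 : 0 <= #|J|%:R :> R by [].
have c1 : 1 <= c by rewrite /c; have := sqr_ge0 L; nra.
have c0 : 0 < c by lra.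
exists (e / c); first by rewrite divr_gt0.
move=> w' close; rewrite -ltr_sqr ?nnegrE ?(ltW e0) // real_normK ?num_real //.
have h1 : (g i (p w') ord0 j - g i (p w) ord0 j) ^+ 2 <=
    L ^+ 2 * sqnp (subp (p w') (p w)).
  apply: le_trans (smooth _ _ (Xp w') (Xp w)).
  apply: (@le_trans _ _ (sqn (g i (p w') - g i (p w)))).
    by have := sqr_coord_le_sqn (g i (p w') - g i (p w)) j; rewrite !mxE.
  by rewrite (bigD1 i) //= lerDl; apply: sumr_ge0 => k _; exact: sqn_ge0.
have h2 : sqnp (subp (p w') (p w)) <= #|J|%:R * (e / c) ^+ 2.
  rewrite /sqnp /sqn /dotv sig_big_dep /=.
  apply: (@le_trans _ _ (\sum_(k : J) (e / c) ^+ 2)).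
    apply: ler_sum => k _; rewrite /subp !mxE -expr2.
    rewrite -[leLHS]real_normK ?num_real // ler_sqr ?nnegrE ?normr_ge0 ?divr_ge0 ?(ltW e0) ?(ltW c0) //.
    exact: ltW (close k).
  by rewrite sumr_const mulr_natl.
apply: (le_lt_trans h1); apply: (le_lt_trans (ler_wpM2l (sqr_ge0 L) h2)).
have e2 : 0 < (e / c) ^+ 2 by rewrite exprn_gt0 // divr_gt0.
have -> : e ^+ 2 = c ^+ 2 * (e / c) ^+ 2 by field; rewrite gt_eqF.
rewrite mulrA ltr_pM2r //; apply: (@lt_le_trans _ _ c).
  by rewrite /c; have := sqr_ge0 L; nra.
by rewrite expr2 ler_pMl.
Qed.

(** * The convergence rate in expectation *)

Unset Implicit Arguments.

Theorem theorem5
  (R : realType) (N : nat) (d : 'I_N -> nat)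
  (* strategy sets *)
  (X : forall i : 'I_N, set 'rV[R]_(d i))
  (* utilities and their block gradients *)
  (v : 'I_N -> prof R d -> R)
  (gv : forall i : 'I_N, prof R d -> 'rV[R]_(d i))
  (* regularizer psi (one per strategy space) and its gradient *)
  (psi : forall i : 'I_N, 'rV[R]_(d i) -> R)
  (gpsi : forall i : 'I_N, 'rV[R]_(d i) -> 'rV[R]_(d i))
  (* perturbation G(pi_i, sigma_i) and its gradient in the first argument *)
  (G : forall i : 'I_N, 'rV[R]_(d i) -> 'rV[R]_(d i) -> R)
  (gG : forall i : 'I_N, 'rV[R]_(d i) -> 'rV[R]_(d i) -> 'rV[R]_(d i))
  (L rho beta gam mu C : R)
  (sigma pmu p0 : prof R d)
  (dO : measure_display) (Omega : measurableType dO)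
  (P : probability Omega R)
  (xi : nat -> forall i : 'I_N, Omega -> 'rV[R]_(d i))
  (pi : nat -> Omega -> prof R d) :
  (0 < N)%N ->
  (* X_i nonempty compact convex *)
  (forall i, X i !=set0 /\ compact (X i) /\ convex_rv (X i)) ->
  (* v_i differentiable on X, gv i its block gradient in pi_i *)
  (forall i p, in_prof X p ->
     exists D : prof R d, prof_diff (v i) D p /\ D i = gv i p) ->
  (* monotone game *)
  (forall p q, in_prof X p -> in_prof X q ->
     \sum_(i < N) dotv (gv i p - gv i q) (p i - q i) <= 0) ->
  (* L-smooth game *)
  (forall p q, in_prof X p -> in_prof X q ->
     \sum_(i < N) sqn (gv i p - gv i q) <= L ^+ 2 * sqnp (subp p q)) ->
  (* psi differentiable and rho-strongly convex on X_i *)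
  0 < rho ->
  (forall i x, X i x -> has_grad (psi i) (gpsi i x) x) ->
  (forall i, strongly_convex_on rho (X i) (psi i)) ->
  (* G : X_i x X_i -> [0, oo), differentiable in its first argument,
     G(., s) strictly convex with minimum value 0 at s *)
  (forall i x s, X i x -> X i s -> 0 <= G i x s) ->
  (forall i s, X i s -> G i s s = 0) ->
  (forall i s, X i s -> strictly_convex_on (X i) (fun x => G i x s)) ->
  (forall i x s, X i x -> X i s -> has_grad (fun y => G i y s) (gG i x s) x) ->
  (* Assumption A, beta, gamma in (0, oo) *)
  0 < beta -> 0 < gam ->
  (forall i s p p', X i s -> X i p -> X i p' ->
     gam * bregman (psi i) (gpsi i) p' p <= G i p' s - G i p s - dotv (gG i p s) (p' - p)
     /\ G i p' s - G i p s - dotv (gG i p s) (p' - p) <= beta * bregman (psi i) (gpsi i) p' p) ->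
  (* the equilibrium pi^{mu,sigma} of the perturbed game *)
  0 < mu -> in_prof X sigma ->
  in_prof X pmu ->
  (forall i x, X i x ->
     v i (upd pmu i x) - mu * G i x (sigma i) <= v i pmu - mu * G i (pmu i) (sigma i)) ->
  (* the noise xi^t_i is a random vector (measurable coordinates) *)
  (forall t i (j : 'I_(d i)), measurable_fun setT (fun w => xi t i w ord0 j)) ->
  (* Assumption B: E[xi^t_i | F_t] = 0 and E[||xi^t_i||^2 | F_t] <= C^2,
     where F_t is generated by the feedback grad v_i(pi^s) + xi^s_i, s < t *)
  (forall t i (j : 'I_(d i)),
     P.-integrable setT (fun w => (xi t i w ord0 j)%:E) /\
     forall A, feedback_sigma (fun s k w => gv k (pi s w) + xi s k w) t A ->
       (\int[P]_(w in A) (xi t i w ord0 j)%:E = 0)%E) ->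
  (forall t i A, feedback_sigma (fun s k w => gv k (pi s w) + xi s k w) t A ->
     (\int[P]_(w in A) (sqn (xi t i w))%:E <= (C ^+ 2)%:E * P A)%E) ->
  (* the iterates are adapted to (F_t) (implied by the construction) *)
  (forall t i (j : 'I_(d i)) (B : set R), measurable B ->
     feedback_sigma (fun s k w => gv k (pi s w) + xi s k w) t
       ((fun w => pi t w i ord0 j) @^-1` B)) ->
  (* MD-SP with noisy feedback, eta_t = 1 / (kappa t + 2 theta), pi^0 = p0 in X *)
  in_prof X p0 ->
  (forall w, pi 0%N w = p0) ->
  (forall t w i, X i (pi t.+1 w i) /\
     forall x, X i x ->
       (1 / (kappa_const mu gam * t%:R + 2 * theta_const mu gam rho beta L)) *
         dotv (gv i (pi t w) + xi t i w - mu *: gG i (pi t w i) (sigma i)) x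
       - bregman (psi i) (gpsi i) x (pi t w i)
       <=
       (1 / (kappa_const mu gam * t%:R + 2 * theta_const mu gam rho beta L)) *
         dotv (gv i (pi t w) + xi t i w - mu *: gG i (pi t w i) (sigma i)) (pi t.+1 w i)
       - bregman (psi i) (gpsi i) (pi t.+1 w i) (pi t w i)) ->
  forall t : nat,
    let theta := theta_const mu gam rho beta L in
    let kappa := kappa_const mu gam in
    (\int[P]_w (bregp psi gpsi pmu (pi t.+1 w))%:E <=
      ((2 * theta - kappa) / (kappa * t%:R + 2 * theta) * bregp psi gpsi pmu p0
       + N%:R * C ^+ 2 / (rho * (kappa * t%:R + 2 * theta)) *
         (1 / kappa * ln (kappa / (2 * theta) * t%:R + 1) + 1 / (2 * theta)))%:E)%E.
Proof.
move=> N0 HX vdiff mono smooth rho0 psig psic _ _ _ Ggrad beta0 gam0 Grel mu0 Xs Xpmu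
  equil mxi xi0 xi2 adapted Xp0 pi0 upd t; cbv zeta.
set theta := theta_const _ _ _ _ _; set kappa := kappa_const _ _.
have Xconv i : convex_rv (X i) by case: (HX i) => _ [].
have Xcomp i : compact (X i) by case: (HX i) => _ [].
have kappa0 : 0 < kappa by rewrite divr_gt0 ?mulr_gt0.
have thetaE : 2 * theta = 2 * kappa + 2 * (mu * beta)
    + 8 * (L ^+ 2 / (mu * gam * rho ^+ 2)).
  by rewrite /theta /kappa /theta_const /kappa_const; field; rewrite !gt_eqF.
have theta0 : 2 * kappa < 2 * theta.
  rewrite thetaE -addrA ltrDl ltr_wpDr ?mulr_gt0 //.
  by rewrite mulr_ge0 // divr_ge0 ?sqr_ge0 // !mulr_ge0 ?ltW ?exprn_gt0.
pose a s : R := kappa * s%:R + 2 * theta.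
have a0 s : 0 < a s.
  by rewrite ltr_wpDl ?mulr_ge0 ?(ltW kappa0) //; lra.
have Xpi s w : in_prof X (pi s w).
  by case: s => [|s] i; [rewrite pi0; exact: Xp0 | case: (upd s w i)].
pose D s w := bregp psi gpsi pmu (pi s w).
have D0 s w : 0 <= D s w := bregp_ge0 rho0 psig psic Xpmu (Xpi s w).
pose Y s w := \sum_(i < N) dotv (xi s i w) (pi s w i - pmu i)
  + (rho * a s)^-1 * sqnp (fun i => xi s i w).
have step s w : a s * D s.+1 w <= (a s - 2 * kappa) * D s w + Y s w.
  rewrite addrA; apply: (step_descent Xconv vdiff mono smooth rho0 psig psic Ggrad
    beta0 gam0 Grel mu0 Xs Xpmu equil _ (Xpi s w) (Xpi s.+1 w)).
    by rewrite /a lerDr mulr_ge0 // ltW.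
  by move=> i x Xx; exact: (upd s w i).2.
(* The inductive step uses [a s.+1 - 2 * kappa = a s - kappa <= a s]. At [s = 0] the coefficient
   [2 * theta - 2 * kappa] is relaxed to [2 * theta - kappa], the value of [a] at index -1. *)
have unrolled s w : a s * D s.+1 w <=
    (2 * theta - kappa) * bregp psi gpsi pmu p0 + \sum_(r < s.+1) Y r w.
  elim: s => [|s IH].
    apply: (le_trans (step 0%N w)); rewrite big_ord_recl big_ord0 addr0 lerD2r.
    rewrite /D /a mulr0 add0r pi0 ler_wpM2r ?(bregp_ge0 rho0 psig psic) //; lra.
  rewrite big_ord_recr addrA; apply: (le_trans (step s.+1 w)); rewrite lerD2r.
  apply: le_trans IH; rewrite ler_wpM2r // /a -natr1; lra.
pose F s := feedback_sigma (fun s k w => gv k (pi s w) + xi s k w) s.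
(* Induction on time avoids a circularity: [adapted] places the preimages under [pi s] in [F s], and
   these are measurable only once the earlier feedback is. *)
have mfb s : forall r i j, (r < s)%N ->
    measurable_fun setT (fun w => (gv i (pi r w) + xi r i w) ord0 j).
  elim: s => // s IH r i j; rewrite ltnS leq_eqVlt => /orP[/eqP ->|]; last exact: IH.
  under eq_fun do rewrite mxE; apply: measurable_funD; last exact: mxi.
  apply: (smooth_gradient_measurable smooth (Xpi s)) => k l _ B mB.
  rewrite setTI; apply: (feedback_sigma_measurable IH); exact: adapted.
have FM s : F s `<=` measurable := feedback_sigma_measurable (mfb s).
have noise s i (j : 'I_(d i)) :
    expectation_le P (fun w => xi s i w ord0 j * (pi s w i - pmu i) ord0 j) 0.
  have [M XM] := compact_coord_bounded j (Xcomp i).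
  have [ix x0] := xi0 s i j.
  have mshift : measurable_fun setT (fun r : R => r - pmu i ord0 j).
    exact: measurable_funB.
  have fS B : measurable B ->
      F s ((fun w => pi s w i ord0 j - pmu i ord0 j) @^-1` B).
    move=> mB; have := mshift measurableT B mB; rewrite setTI; exact: (adapted s i j).
  have fM w : `|pi s w i ord0 j - pmu i ord0 j| <= M + M.
    by apply: (le_trans (ler_normB _ _)); rewrite lerD // XM //; exact: Xpi.
  have [iI I0] := integral_mul_orthogonal (@FM s) fS fM ix x0.
  have E : (fun w => xi s i w ord0 j * (pi s w i - pmu i) ord0 j) =
      (fun w => (pi s w i ord0 j - pmu i ord0 j) * xi s i w ord0 j).
    by apply/funext => w; rewrite !mxE mulrC.
  by rewrite E; split => //; rewrite I0.
have noise2 s i : expectation_le P (fun w => sqn (xi s i w)) (C ^+ 2).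
  apply: expectation_le_ge0.
  - by apply: measurable_sum => j; apply: measurable_funM; exact: mxi.
  - by move=> w; exact: sqn_ge0.
  (* The conditional second-moment bound is integrated over the whole space, which lies in [F s] as
     the complement of the empty set. *)
  - have FT : F s setT.
      by rewrite -(setD0 setT); apply: sigma_algebraCD; exact: sigma_algebra0.
    by have := xi2 s i setT FT; rewrite probability_setT mule1.
have EY s : expectation_le P (Y s) ((rho * a s)^-1 * (N%:R * C ^+ 2)).
  rewrite -[X in expectation_le P _ X]add0r; apply: expectation_leD.
    (* The bound [0] is recast as a double sum to match the coordinatewise expansion of the inner
       products. *)
    have E : \sum_(i < N) \sum_(j < d i) 0 = 0 :> R.
      by rewrite big1 // => i _; rewrite big1.
    rewrite -[X in expectation_le P _ X]E.
    exact: (expectation_le_sum (index_enum _)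
      (fun i => expectation_le_sum (index_enum _) (fun j => noise s i j))).
  apply: expectation_leZ; first by rewrite invr_ge0 mulr_ge0 // ltW.
  rewrite mulr_natl -[in X in expectation_le P _ X](card_ord N) -sumr_const.
  exact: (expectation_le_sum (index_enum _) (fun i => noise2 s i)).
have := expectation_leZ (k := (a t)^-1) _ (expectation_leD
  (expectation_le_cst P ((2 * theta - kappa) * bregp psi gpsi pmu p0))
  (expectation_le_sum (index_enum 'I_t.+1) (fun r : 'I_t.+1 => EY r))).
rewrite invr_ge0 (ltW (a0 t)) => /(_ isT) [_ bound].
(* The divergence is compared pointwise with the integrable majorant given by [unrolled], divided by
   [a t]. *)
apply: (le_trans (ge0_le_integralT _ _ _) (le_trans bound _)).
- by move=> w; rewrite lee_fin; exact: D0.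
- by move=> w; rewrite lee_fin mulrC ler_pdivlMr // mulrC; exact: unrolled.
rewrite lee_fin mulrDr.
have a20 : 0 < 2 * theta by lra.
have -> : (a t)^-1 * (\sum_(r < t.+1) (rho * a r)^-1 * (N%:R * C ^+ 2)) =
    N%:R * C ^+ 2 / (rho * a t) * \sum_(r < t.+1) (a r)^-1.
  by rewrite !mulr_sumr; apply: eq_bigr => r _; field; rewrite !gt_eqF.
have -> : (a t)^-1 * ((2 * theta - kappa) * bregp psi gpsi pmu p0) =
    (2 * theta - kappa) / a t * bregp psi gpsi pmu p0 by rewrite mulrA [_^-1 * _]mulrC.
rewrite lerD2l ler_wpM2l //; last exact: sum_inv_affine_le.
by apply: divr_ge0; apply: mulr_ge0; rewrite ?ler0n ?sqr_ge0 ?(ltW rho0) ?(ltW (a0 t)).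
Qed.
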